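(* Let $(X,\|\cdot\|)$ be a real normed space, $X_o=X\setminus\{o\}$, and let $\mathrm{ang}:X_o\times X_o\to[0,\pi]$ be a function satisfying: (continuity) for each fixed $x\in X_o$ the functions $y\mapsto\mathrm{ang}(x,y)$ and $y\mapsto\mathrm{ang}(y,x)$ are continuous on $X_o$ and surjective onto $[0,\pi]$; (homogeneity) $\mathrm{ang}(\alpha x,\beta y)=\mathrm{ang}(x,y)$ for all $x,y\in X_o$ and $\alpha,\beta>0$; (non-degeneracy) $\mathrm{ang}(x,y)=0$ if and only if $x=\alpha y$ for some $\alpha>0$; (parallelism) $\mathrm{ang}(x,y)=\pi$ if and only if $y=\alpha x$ for some $\alpha<0$. Let $x,y\in X_o$ be linearly independent and suppose that the function $f:t\mapsto\mathrm{ang}(y,x+ty)$, $t\in\mathbb{R}$, is injective. Then $f$ is a (strictly) decreasing homeomorphism from $\mathbb{R}$ onto $(0,\pi)$. *)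

(* Defs.v *)
From mathcomp Require Import all_boot all_order all_algebra.
From mathcomp Require Import all_classical all_reals all_analysis.
Import Order.TTheory GRing.Theory Num.Theory.
Import numFieldNormedType.Exports.

Set Implicit Arguments.
Unset Strict Implicit.
Unset Printing Implicit Defensive.

Local Open Scope classical_set_scope.
Local Open Scope ring_scope.

Definition nonzero (V : zmodType) : set V := [set x | x != 0].
Arguments nonzero V : clear implicits.

(* [free] is only available in finite dimension (vectType). *)
Definition linearly_independent2 (R : pzRingType) (V : lmodType R) (x y : V) :
    Prop :=
  forall a b : R, a *: x + b *: y = 0 -> a = 0 /\ b = 0.

(* An angle is a function on pairs of nonzero vectors; it is encoded as a total
   function whose values at pairs containing 0 are left unconstrained. *)
Record is_angle (R : realType) (X : normedModType R) (ang : X -> X -> R) :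
    Prop := IsAngle {
  angle_range : forall x y : X, x != 0 -> y != 0 -> `[0, pi]%classic (ang x y);
  angle_continuousr : forall x : X, x != 0 ->
    {within nonzero X, continuous (fun y => ang x y)};
  angle_continuousl : forall x : X, x != 0 ->
    {within nonzero X, continuous (fun y => ang y x)};
  angle_surjr : forall x : X, x != 0 ->
    set_surj (nonzero X) `[0, pi] (fun y => ang x y);
  angle_surjl : forall x : X, x != 0 ->
    set_surj (nonzero X) `[0, pi] (fun y => ang y x);
  angle_homogeneous : forall (x y : X) (a b : R), x != 0 -> y != 0 ->
    0 < a -> 0 < b -> ang (a *: x) (b *: y) = ang x y;
  angle_eq0 : forall x y : X, x != 0 -> y != 0 ->
    ang x y = 0 <-> exists a : R, 0 < a /\ x = a *: y;
  angle_eqpi : forall x y : X, x != 0 -> y != 0 ->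
    ang x y = pi <-> exists a : R, a < 0 /\ y = a *: x
}.

(* [f] restricts to a homeomorphism from [A] onto [B], both with the subspace
   topology. *)
Definition homeomorphism_onto (T U : topologicalType) (A : set T) (B : set U)
    (f : T -> U) : Prop :=
  [/\ set_bij A B f,
      {within A, continuous f} &
      exists g : U -> T,
        [/\ {in A, cancel f g}, {in B, cancel g f} &
            {within B, continuous g}]].

(* Main.v *)
(* By homogeneity, ang(y, x + ty) equals ang(y, t^-1 x + y) for t > 0 and
   ang(y, -t^-1 x - y) for t < 0, so continuity of the angle at y and -y gives
   the limits 0 at +oo and pi at -oo. These values are not attained, by
   non-degeneracy, parallelism and linear independence. An injective continuous
   function on the line is strictly monotone, and the limits fix the direction
   and, with the intermediate value theorem, the image. *)
Require Import Defs.
From mathcomp Require Import all_boot all_order all_algebra.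
From mathcomp Require Import all_classical all_reals all_analysis.
Import Order.TTheory GRing.Theory Num.Theory.
Import numFieldNormedType.Exports.

Local Open Scope classical_set_scope.
Local Open Scope ring_scope.

(** This isolates the real analysis: once the bounds and the two limits of the angle function are
    known, no geometry remains. *)
Lemma continuous_injective_decreasing_homeomorphism (R : realType)
    (f : R -> R) (a b : R) :
  continuous f -> injective f -> (forall t, a < f t < b) ->
  f t @[t --> +oo] --> a -> f t @[t --> -oo] --> b ->
  decreasing_fun f /\ homeomorphism_onto [set: R] `]a, b[ f.
Proof.
move=> fcont finj fab fa fb.
have smally c s : a < c -> exists2 t, s < t & f t < c.
  move=> ac; near (pinfty_nbhs R) => t; exists t; near: t.
    by apply: nbhs_pinfty_gt; exact: num_real.
  exact: (cvgr_lt a fa).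
have largeNy c s : c < b -> exists2 t, t < s & c < f t.
  move=> cb; near (ninfty_nbhs R) => t; exists t; near: t.
    by apply: nbhs_ninfty_lt; exact: num_real.
  exact: (cvgr_gt b fb).
have fdec : decreasing_fun f.
  (* A continuous injection is strictly monotone, so the single pair [0 < t] with [f t < f 0]
     settles the direction. *)
  have [|t t0 ft0] := smally (f 0) 0; first by have /andP[] := fab 0.
  move=> u v; apply: (@itv_continuous_inj_ge _ f `]-oo, +oo[) => //.
  - by exists 0, t; split; rewrite ?in_itv//= ltW.
  - exact: continuous_subspaceT.
  - by move=> ? ? _ _; exact: finj.
have fsurj c : `]a, b[%classic c -> exists t, f t = c.
  rewrite /= in_itv/= => /andP[ac cb].
  (* Choosing [s] after [t] gives [s < t] with [f t < c < f s], ready for the intermediate value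
     theorem. *)
  have [t _ ftc] := smally c 0 ac; have [s st cfs] := largeNy c t cb.
  have [||d _ <-] := @IVT R f s t c (ltW st); last by exists d.
    exact: continuous_subspaceT.
  by rewrite ge_min le_max (ltW ftc) (ltW cfs) orbT.
(* The default 0 is taken only off the range of [f], hence outside []a, b[]. *)
pose g c := xget 0 [set t | f t = c].
have gE c : (exists t, f t = c) -> f (g c) = c.
  exact: (@xgetPex _ 0 [set t | f t = c]).
have fK : cancel f g by move=> t; apply: finj; apply: gE; exists t.
have gK : {in `]a, b[%classic, cancel g f} by move=> c /set_mem/fsurj/gE.
split=> //; split.
- split.
  + by move=> t _; rewrite /= in_itv/= fab.
  + by move=> ? ? _ _; exact: finj.
  + by move=> c /fsurj[t ftc]; exists t.
- exact: continuous_subspaceT.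
- exists g; split=> //; apply: continuous_in_subspaceT => c /set_mem/fsurj[t <-].
  (* A left inverse of a function continuous near [t] is continuous near [f t]; every point of []a,
     b[] is such an [f t]. *)
  have /nbhs_singleton : {near f t, continuous g}; last exact.
  by apply: near_can_continuous; near=> u; [exact: fK|exact: fcont].
Unshelve. all: by end_near. Qed.

(** Points are closed in a normed space, so the nonzero vectors form an open set, on which relative
    continuity is ordinary continuity. *)
Lemma angle_continuous_at (R : realType) (X : normedModType R)
    (ang : X -> X -> R) (hang : is_angle ang) (x y : X) :
  x != 0 -> y != 0 -> ang x z @[z --> y] --> ang x y.
Proof.
move=> x0 y0; have := angle_continuousr hang x0.
rewrite continuous_open_subspace; first by apply; rewrite inE.
have -> : nonzero X = ~` [set 0] by apply/seteqP; split=> z /= /eqP.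
apply: closed_openC; apply: accessible_closed_set1.
exact/hausdorff_accessible/norm_hausdorff.
Qed.

(** The filter is left general so as to serve both ends of the line, with [z] equal to [y] or
    [- y]. *)
Lemma angle_translate_cvg (R : realType) (X : normedModType R)
    (ang : X -> X -> R) (hang : is_angle ang) (T : Type) (F : set_system T)
    (x y z : X) (u : T -> R) :
  Filter F -> y != 0 -> z != 0 -> u t @[t --> F] --> 0 ->
  ang y (u t *: x + z) @[t --> F] --> ang y z.
Proof.
move=> FF y0 z0 u0.
have : u t *: x + z @[t --> F] --> z.
  rewrite -[X in _ --> X](add0r z) -[X in _ --> X + _](scale0r x).
  by apply: cvgD; [exact: cvgZr_tmp|exact: cvg_cst].
by move=> /cvg_comp; apply; exact: angle_continuous_at.
Qed.

Theorem theorem3p3p1 (R : realType) (X : normedModType R) (ang : X -> X -> R)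
    (hang : is_angle ang) (x y : X) (hx : x != 0) (hy : y != 0)
    (hxy : linearly_independent2 x y)
    (f : R -> R) (hf : f = (fun t : R => ang y (x + t *: y)))
    (finj : injective f) :
  decreasing_fun f /\ homeomorphism_onto [set: R] `]0, pi[ f.
Proof.
(* By independence the coefficient [a] of [x] vanishes. This yields [x + t *: y != 0] and excludes
   the angles 0 and [pi]. *)
have xtyZ a b t : b *: y = a *: (x + t *: y) -> a = 0.
  move=> /eqP; rewrite eq_sym -subr_eq0 scalerDr scalerA -addrA -scalerBl.
  by move=> /eqP/hxy[].
have xty0 t : x + t *: y != 0.
  apply/eqP => e; have := xtyZ 1 0 t; rewrite e scale0r scaler0 => /(_ erefl).
  by move/eqP; rewrite oner_eq0.
have Ny0 : - y != 0 by rewrite oppr_eq0.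
have angyy : ang y y = 0.
  by apply/(angle_eq0 hang hy hy); exists 1; rewrite scale1r.
have angyNy : ang y (- y) = pi.
  apply/(angle_eqpi hang hy Ny0); exists (-1).
  by rewrite scaleN1r ltrN10.
rewrite {}hf in finj *.
apply: continuous_injective_decreasing_homeomorphism => //.
- move=> t; have := angle_continuous_at _ _ _ hang _ _ hy (xty0 t).
  apply: cvg_comp; apply: cvgD; first exact: cvg_cst.
  by apply: cvgZr_tmp; exact: cvg_id.
- move=> t; have := angle_range hang hy (xty0 t).
  rewrite /= in_itv/= !lt_def => /andP[-> ->]; rewrite !andbT.
  apply/andP; split; apply/eqP.
    move=> /(angle_eq0 hang hy (xty0 t))[a [a0 ya]].
    by move: a0; rewrite (xtyZ a 1 t) ?ltxx// scale1r.
  move=> /esym/(angle_eqpi hang hy (xty0 t))[a [_ e]].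
  by have /eqP := xtyZ 1 a t (esym (etrans (scale1r _) e)); rewrite oner_eq0.
- rewrite -angyy.
  have u0 : (t : R)^-1 @[t --> +oo] --> (0 : R).
    apply/gtr0_cvgV0; last exact: cvg_id.
    by apply: nbhs_pinfty_gt; exact: num_real.
  have := angle_translate_cvg _ _ _ hang _ _ x y y _ (@proper_pinfty_nbhs R) hy hy u0.
  apply: cvg_trans; apply: near_eq_cvg; near=> t.
  have t0 : 0 < t by near: t; apply: nbhs_pinfty_gt; exact: num_real.
  rewrite -(angle_homogeneous hang hy (xty0 t) ltr01 (_ : 0 < t^-1)) ?invr_gt0//.
  by rewrite scale1r scalerDr scalerA mulVf ?scale1r ?gt_eqF.
- rewrite -angyNy.
  have u0 : - (t : R)^-1 @[t --> -oo] --> (0 : R).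
    rewrite -oppr0; apply: cvgN; apply/ltr0_cvgV0; last exact: cvg_id.
    by apply: nbhs_ninfty_lt; exact: num_real.
  have := angle_translate_cvg _ _ _ hang _ _ x y (- y) _ (@proper_ninfty_nbhs R) hy Ny0 u0.
  apply: cvg_trans; apply: near_eq_cvg; near=> t.
  have t0 : t < 0 by near: t; apply: nbhs_ninfty_lt; exact: num_real.
  (* Homogeneity needs a positive factor; for [t < 0] this is [- t^-1], which sends [t *: y] to
     [- y]. *)
  rewrite -(angle_homogeneous hang hy (xty0 t) ltr01 (_ : 0 < - t^-1)).
    by rewrite scale1r scalerDr scalerA mulNr mulVf ?scaleN1r ?lt_eqF.
  by rewrite oppr_gt0 invr_lt0.
Unshelve. all: by end_near. Qed.
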